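(* Let $(X,d)$ be a metric space and let $\mathbb{P}(X)$ be the space of Borel probability measures on $X$ endowed with the topology of weak convergence. If $\mathbb{P}(X)$ is a $\sigma$-compact space, then $X$ is a $\sigma$-compact space.
   Context: The topology of weak convergence on $\mathbb{P}(X)$, for a metric space $X$ with Borel $\sigma$-algebra $\mathcal{B}(X)$, is the coarsest topology on the set $\mathbb{P}(X)$ of probability measures on $\mathcal{B}(X)$ that makes the mapping $\mu \mapsto \int_X v(y)\,\mu(dy)$ continuous for every bounded continuous function $v: X\to\mathbb{R}$. A topological space is $\sigma$-compact if it is a countable union of compact subsets. *)

(* Defs.v *)
From HB Require Import structures.
From mathcomp Require Import all_boot all_order all_algebra.
From mathcomp Require Import all_classical all_reals all_analysis.
From mathcomp Require Import measurable_realfun.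

Set Implicit Arguments.
Unset Strict Implicit.
Unset Printing Implicit Defensive.

Import Order.TTheory GRing.Theory Num.Theory.
Import numFieldNormedType.Exports.
Local Open Scope classical_set_scope.
Local Open Scope ring_scope.

Definition sigma_compact_space (T : topologicalType) : Prop :=
  exists2 K : (set T)^nat, (forall n, compact (K n)) & \bigcup_n K n = [set: T].

(* A metric space may be empty, whereas every [measurableType] is pointed.  The
   Borel measurable space is therefore indexed by a base point [x0]; neither its
   carrier nor its sigma-algebra depends on [x0]. *)
Definition pointed_at (X : choiceType) (x0 : X) : Type := X.
HB.instance Definition _ (X : choiceType) (x0 : X) :=
  Choice.on (pointed_at x0).
HB.instance Definition _ (X : choiceType) (x0 : X) :=
  isPointed.Build (pointed_at x0) x0.

Definition borel_space (X : topologicalType) (x0 : X) : measurableType _ :=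
  @g_sigma_algebraType (pointed_at x0) (@open X).

Definition borel_set (X : topologicalType) : Type :=
  {A : set X | <<s @open X >> A}.

(* A Borel probability measure is a function on the Borel sets only: the
   library's [probability] is a function on all subsets, with arbitrary values
   on the non-measurable ones, and these values are discarded here.  If [X] is
   empty then there is no such measure. *)
Record borel_probability (R : realType) (X : topologicalType) : Type :=
  BorelProbability {
    bprob_fun :> borel_set X -> \bar R ;
    bprobP : exists x0 : X, exists P : probability (borel_space x0) R,
      forall A : borel_set X, bprob_fun A = P (sval A)
  }.

HB.instance Definition _ (R : realType) (X : topologicalType) :=
  gen_eqMixin (borel_probability R X).
HB.instance Definition _ (R : realType) (X : topologicalType) :=
  gen_choiceMixin (borel_probability R X).

Section borel_probability_integral.
Context {R : realType} {X : topologicalType}.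
Implicit Type mu : borel_probability R X.

Definition bprob_point mu : X := projT1 (cid (bprobP mu)).

Definition bprob_extension mu : probability (borel_space (bprob_point mu)) R :=
  projT1 (cid (projT2 (cid (bprobP mu)))).

(* The choice of the base point and of the extension is immaterial, see
   [bprob_integralE]. *)
Definition bprob_integral (v : X -> R) mu : R :=
  \int[bprob_extension mu]_y v y.

Lemma bprob_extensionE mu (A : borel_set X) :
  bprob_extension mu (sval A) = mu A.
Proof. exact/esym/(projT2 (cid (projT2 (cid (bprobP mu))))). Qed.

Lemma continuous_borel_measurable (x0 : X) (v : X -> R) :
  continuous v -> measurable_fun [set: borel_space x0] v.
Proof.
move=> /continuousP cv.
apply: (measurability _ (RGenOInfty.measurableE R)) => //.
move=> _ [_ [r ->] <-]; rewrite setTI; apply: sub_sigma_algebra.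
exact/cv/interval_open.
Qed.

Lemma bprob_integralE mu (x0 : X) (P : probability (borel_space x0) R)
    (v : X -> R) :
  continuous v -> bounded_fun v ->
  (forall A : borel_set X, mu A = P (sval A)) ->
  bprob_integral v mu = \int[P]_y v y.
Proof.
move=> cv bv muP; rewrite /bprob_integral /Rintegral; congr fine.
set Q := bprob_extension mu.
have mid : measurable_fun [set: borel_space x0]
    (id : borel_space x0 -> borel_space (bprob_point mu)).
  by move=> _ A mA; rewrite setTI.
have mv := continuous_borel_measurable (x0 := bprob_point mu) cv.
have iv : P.-integrable [set: borel_space x0] (EFin \o v).
  apply: measurable_bounded_integrable; [exact: measurableT| | |exact: bv].
  - exact: le_lt_trans (probability_le1 P measurableT) (ltry 1).
  - exact: continuous_borel_measurable.
transitivity (\int[pushforward P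
    (id : borel_space x0 -> borel_space (bprob_point mu))]_y (v y)%:E)%E.
  apply: eq_measure_integral => A mA _.
  by have := bprob_extensionE mu (exist _ A mA); rewrite muP.
by rewrite integral_pushforward//; exact/measurable_EFinP.
Qed.

End borel_probability_integral.

Definition bounded_continuous (R : realType) (X : topologicalType) : Type :=
  {v : X -> R | continuous v /\ bounded_fun v}.

(* The coarsest topology making every [bprob_integral v], for [v] bounded and
   continuous, continuous. *)
Definition weak_probability (R : realType) (X : topologicalType) : Type :=
  sup_topology (fun v : bounded_continuous R X =>
    Topological.class (initial_topology (@bprob_integral R X (sval v)))).

HB.instance Definition _ (R : realType) (X : topologicalType) :=
  Topological.on (weak_probability R X).

(* Main.v *)
(* If the Dirac measures of a sequence [u] cluster at [mu], then [u] clusters: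
   otherwise the range [D] of [u] is closed and each [u n] has a neighbourhood
   that [u] eventually leaves, so that, testing against Urysohn functions, [mu]
   vanishes on an open set containing [D], whereas a Urysohn function equal to
   1 on [D] and to 0 off this open set has integral 1.  Hence sequences in the
   preimage of a compact set of measures under [x |-> \d_x] cluster in [X], and
   the closure of this preimage is compact.  Arguing with sequences is
   essential: on a discrete space of measurable cardinality the Dirac measures
   do not form a closed set. *)
Require Import Defs.
From mathcomp Require Import all_boot all_order all_algebra.
From mathcomp Require Import all_classical all_reals all_analysis.
From mathcomp Require Import measurable_realfun.

Set Implicit Arguments.
Unset Strict Implicit.
Unset Printing Implicit Defensive.

Import Order.TTheory GRing.Theory Num.Theory.
Import numFieldNormedType.Exports.
Local Open Scope classical_set_scope.
Local Open Scope ring_scope.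

Lemma not_cluster_seq (T : topologicalType) (u : T^nat) (x : T) :
  ~ cluster (u @ \oo) x ->
  exists A, nbhs x A /\ \forall n \near \oo, ~ A (u n).
Proof.
move=> ucl; apply: contrapT => nA; apply: ucl => B A uB xA.
apply: contrapT => BA0; apply: nA; exists A; split => //.
near=> n => An; have Bn : B (u n) by near: n; exact: uB.
by apply: BA0; exists (u n).
Unshelve. all: by end_near. Qed.

(** A point off the range has a neighbourhood that [u] eventually leaves; the finitely many earlier
    terms form a closed set, which can be removed from it. *)
Lemma closed_range_not_cluster (T : topologicalType) (u : T^nat) :
  hausdorff_space T -> (forall x, ~ cluster (u @ \oo) x) -> closed (range u).
Proof.
move=> hT ucl x; apply: contraPP => ux.
have [A [xA [N _ uA]]] := not_cluster_seq (ucl x).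
have Ecl : closed (u @` `I_N).
  apply: (accessible_finite_set_closed.1 (hausdorff_accessible hT)).
  exact/finite_image/finite_II.
have xE : nbhs x (~` (u @` `I_N)).
  by apply: open_nbhs_nbhs; split; [exact: closed_openC|case=> i _ ix; apply: ux; exists i].
move=> /(_ _ (filterI xA xE))[_ [[n _ <-] [An En]]].
have [Nn|nN] := leqP N n; first exact: uA An.
by apply: En; exists n.
Qed.

(* The points of [F] can be chosen successively outside of the balls around
   the previous ones unless one of these balls belongs to the ultrafilter. *)
Lemma ultra_closure_ball (R : realType) (X : pseudoMetricType R) (F : set X)
    (U : set_system X) (e : R) :
  (forall u : X^nat, (forall n, F (u n)) -> exists x, cluster (u @ \oo) x) ->
  UltraFilter U -> U (closure F) -> 0 < e -> exists2 c, F c & U (ball c e).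
Proof.
move=> Fcl UU UF e0; apply: contrapT => nball.
(* No ball of radius [e] around a point of [F] lies in [U], so [U] contains the complement of
   finitely many of them. This gives a point [y] of [closure F], and a point [z] of [F] within
   [e / 2] of [y] still avoids the balls of half the radius. *)
have sep (s : seq X) : exists z, F z /\
    forall x, x \in s -> F x -> ~ ball x (e / 2) z.
  have Us : U (closure F `&` [set z | forall x, x \in s -> F x -> ~ ball x e z]).
    apply: filterI => //; elim: s => [|a s IH]; first by apply: filterE => z x.
    have [Fa|Fa] := pselect (F a); last first.
      by apply: filterS IH => z sz x /[!inE] /predU1P[->//|]; exact: sz.
    have [Ua|Ua] := in_ultra_setVsetC (ball a e) UU; first by case: nball; exists a.
    apply: filterS (filterI IH Ua) => z [sz az] x.
    by rewrite inE => /predU1P[-> _|]; [exact: az|exact: sz].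
  have /filter_ex[y [Fy sy]] := Us.
  have e20 : 0 < e / 2 by rewrite divr_gt0.
  have [z [Fz yz]] := Fy _ (nbhsx_ballx y _ e20).
  exists z; split=> // x xs Fx xz; apply: (sy x xs Fx).
  by rewrite (splitr e); apply: ball_triangle xz (ball_sym yz).
have [g gP] := choice sep.
(* [st n] lists the first [n] terms of [u], so [u n] avoids the balls around all of them. *)
pose st n := iter n (fun s => g s :: s) [::].
pose u n := g (st n).
have Fu n : F (u n) by have [] := gP (st n).
have stu m n : (m < n)%N -> u m \in st n.
  elim: n => // n IH; rewrite ltnS leq_eqVlt => /predU1P[->|/IH mn].
    by rewrite /= inE eqxx.
  by rewrite /= inE mn orbT.
have [x xcl] := Fcl u Fu.
(* Two terms within a quarter of [e] of the cluster point are too close to each other. *)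
have e40 : 0 < e / 2 / 2 by rewrite !divr_gt0.
have ux N : exists2 n, (N <= n)%N & ball x (e / 2 / 2) (u n).
  have : (u @ \oo) [set u n | n in [set n | (N <= n)%N]].
    by exists N => // n /= Nn; exists n.
  by move=> /xcl/(_ (nbhsx_ballx _ _ e40))[_ [[n Nn <-] xn]]; exists n.
have [m _ xm] := ux 0%N; have [n mn xn] := ux m.+1.
have [_ /(_ _ (stu _ _ mn) (Fu m))] := gP (st n); apply.
by rewrite (splitr (e / 2)); apply: ball_triangle xn; exact: ball_sym.
Qed.

(** An ultrafilter on [closure F] contains balls of radius [n.+1%:R^-1] centred at points [c n] of
    [F], and it converges to any cluster point of [c]. *)
Lemma compact_closure_cluster (R : realType) (X : pseudoMetricType R)
    (F : set X) :
  (forall u : X^nat, (forall n, F (u n)) -> exists x, cluster (u @ \oo) x) ->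
  compact (closure F).
Proof.
move=> Fcl; rewrite compact_ultra => U UU UF.
have sm n : exists c, F c /\ U (ball c (n.+1%:R^-1 : R)).
  have [|c] := ultra_closure_ball Fcl UU UF (e := n.+1%:R^-1); first by rewrite invr_gt0.
  by exists c.
have [c cP] := choice sm.
have [x xcl] := Fcl c (fun n => (cP n).1).
suff Ux : U --> x.
  exists x; split => //; apply: closed_closure.
  by move=> A xA; apply: (@filter_ex _ U); apply: filterI => //; exact: Ux.
move=> A /nbhs_ballP[e /= e0 xeA].
have e20 : 0 < e / 2 by rewrite divr_gt0.
have [N _ Ne] : \forall n \near \oo, n.+1%:R^-1 < e / 2.
  exact: near_infty_natSinv_lt (PosNum e20).
have [||_ [[n Nn <-] xn]] := xcl [set c n | n in [set n | (N <= n)%N]] (ball x (e / 2)).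
- by exists N => // n /= Nn; exists n.
- exact: nbhsx_ballx.
apply: filterS (cP n).2 => y cy; apply: xeA.
rewrite (splitr e); apply: ball_triangle xn _.
by apply: le_ball cy; exact/ltW/Ne.
Qed.

Section weak_topology.
Context {R : realType} {X : topologicalType}.
Implicit Types (mu : borel_probability R X) (u : X^nat) (v : X -> R).

Lemma dirac_borel_probability (x : X) :
  exists x0 : X, exists P : probability (borel_space x0) R,
    forall A : borel_set X, \d_(x : borel_space x) (sval A) = P (sval A).
Proof. by exists x, (\d_(x : borel_space x)). Qed.

Definition dirac_bprob (x : X) : weak_probability R X :=
  BorelProbability (dirac_borel_probability x).

Lemma bprob_integral_dirac v x :
  continuous v -> bounded_fun v -> bprob_integral v (dirac_bprob x) = v x.
Proof.
move=> cv bv; rewrite (@bprob_integralE _ _ _ x (\d_(x : borel_space x)))//.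
rewrite /Rintegral integral_dirac// ?diracT ?mul1e//.
apply/measurable_EFinP.
exact: (continuous_borel_measurable (x0:=x) cv).
Qed.

Lemma bprob_integral_continuous v : continuous v -> bounded_fun v ->
  continuous (bprob_integral v : weak_probability R X -> R).
Proof.
move=> cv bv mu.
pose w : bounded_continuous R X := exist _ v (conj cv bv).
have /cvg_sup/(_ w) : nbhs mu --> mu by [].
move=> muw A /(@initial_continuous _ _ (bprob_integral v) mu); exact: muw.
Qed.

Lemma integrable_bprob_extension mu v : continuous v -> bounded_fun v ->
  (bprob_extension mu).-integrable setT (EFin \o v).
Proof.
move=> cv bv; apply: measurable_bounded_integrable => //.
- exact: le_lt_trans (probability_le1 _ measurableT) (ltry 1).
- exact: continuous_borel_measurable.
Qed.

(** Integrating [v] against the Dirac measure at [u n] gives [v (u n)], and the integral of [v] is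
    weakly continuous in the measure. *)
Lemma cluster_bprob_integral mu u v (c : R) : continuous v -> bounded_fun v ->
  cluster ((dirac_bprob \o u) @ \oo) mu -> (\forall n \near \oo, v (u n) = c) ->
  bprob_integral v mu = c.
Proof.
move=> cv bv umu [N _ uc].
apply/eqP; rewrite -subr_eq0 -normr_eq0; apply/eqP/le_anti.
rewrite normr_ge0 andbT; apply/ler_addgt0Pl => e e0; rewrite addr0.
have mue : \forall nu \near (mu : weak_probability R X),
    `|bprob_integral v mu - bprob_integral v nu| < e.
  by have /cvgrPdist_lt := @bprob_integral_continuous v cv bv mu; exact.
have uN : ((dirac_bprob \o u) @ \oo)
    [set dirac_bprob (u n) | n in [set n | (N <= n)%N]].
  by exists N => // n /= Nn; exists n.
have [_ [[n Nn <-]]] := umu _ _ uN mue.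
by rewrite /= bprob_integral_dirac// uc// => /ltW.
Qed.

Lemma bounded_fun_itv01 v : range v `<=` `[0, 1] -> bounded_fun v.
Proof.
move=> v01; exists 1; split => // M M1 x _ /=.
have /v01 : range v (v x) by exists x.
by rewrite /= in_itv/= => /andP[v0 v1]; rewrite ger0_norm// (le_trans v1)// ltW.
Qed.

Lemma open_borel_measurable (x0 : X) (O : set X) :
  open O -> measurable (O : set (borel_space x0)).
Proof. exact: sub_sigma_algebra. Qed.

Lemma cluster_open_null mu u x : normal_space X -> regular_space X ->
  cluster ((dirac_bprob \o u) @ \oo) mu -> ~ cluster (u @ \oo) x ->
  exists O, [/\ open O, O x & bprob_extension mu O = 0%E].
Proof.
move=> nX rX umu ucl.
have [A [xA uA]] := not_cluster_seq ucl.
have [B xB BA] := rX x _ (nbhs_interior xA).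
pose A' : set X := ~` A°.
have cA' : closed A' by apply: open_closedC; exact: open_interior.
(* Since [u] eventually stays in [A'], where [v] vanishes, [v] has integral 0; as [v] dominates the
   indicator of the interior of [B], that interior is null. *)
have /(@uniform_separatorP _ R)[v [cv v01 v0 v1]] : @uniform_separator X A' (closure B).
  apply: ((@normal_separatorP R X).1 nX) => //; first exact: closed_closure.
  by apply/disjoints_subset => y A'y /BA.
have bv := bounded_fun_itv01 v01.
have v_ge0 y : 0 <= v y.
  by have /v01 : range v (v y) by []; rewrite /= in_itv/= => /andP[].
have muv0 : bprob_integral v mu = 0.
  apply: (cluster_bprob_integral cv bv umu).
  near=> n; apply: v0; exists (u n) => // /interior_subset.
  by near: n.
exists B°; split; [exact: open_interior|by []|].
have mB := @open_borel_measurable (bprob_point mu) _ (open_interior B).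
apply/le_anti; rewrite measure_ge0 andbT.
have iv := integrable_bprob_extension mu cv bv.
have -> : 0%E = (\int[bprob_extension mu]_y (v y)%:E)%E.
  rewrite -[RHS]fineK; first by rewrite -[fine _]/(bprob_integral v mu) muv0.
  exact: integrable_fin_num iv.
rewrite -[B°]setIT -integral_indic//; apply: ge0_le_integral => //.
- exact/measurable_EFinP/measurable_indic.
- exact: measurable_int iv.
move=> y _; rewrite lee_fin indicE; case: (boolP (_ \in _)) => [/set_mem By|_ //].
rewrite (v1 (v y))//; exists y => //.
by apply: subset_closure; exact: interior_subset By.
Unshelve. all: by end_near. Qed.

Lemma cluster_open_pos mu u (D O : set X) : normal_space X ->
  cluster ((dirac_bprob \o u) @ \oo) mu -> closed D -> open O -> D `<=` O ->
  (\forall n \near \oo, D (u n)) -> bprob_extension mu O != 0%E.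
Proof.
move=> nX umu cD oO DO uD; apply/eqP => mu0.
have /(@uniform_separatorP _ R)[v [cv v01 v0 v1]] : @uniform_separator X (~` O) D.
  apply: ((@normal_separatorP R X).1 nX) => //; first exact: open_closedC.
  by apply/disjoints_subset => y Oy /DO.
have bv := bounded_fun_itv01 v01.
have : bprob_integral v mu = 1.
  apply: (cluster_bprob_integral cv bv umu).
  by near=> n; apply: v1; exists (u n) => //; near: n.
have mO := @open_borel_measurable (bprob_point mu) _ oO.
(* Discarding the null set [O] leaves only points where [v] is 0, against the integral 1. *)
rewrite /bprob_integral /Rintegral (negligible_integral mO)//; last first.
  exact: integrable_bprob_extension.
rewrite integral0_eq/= => [/eqP|y [_ Oy]]; first by rewrite eq_sym oner_eq0.
by rewrite (v0 (v y))//; exists y.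
Unshelve. all: by end_near. Qed.

End weak_topology.

Lemma cluster_dirac_bprob (R : realType) (X : metricType R) (u : X^nat)
    (mu : weak_probability R X) :
  cluster ((dirac_bprob \o u) @ \oo) mu -> exists x, cluster (u @ \oo) x.
Proof.
move=> umu; apply: contrapT => /forallNP ucl.
have cu := closed_range_not_cluster (@metric_hausdorff R X) ucl.
have nX := @pseudometric_normal R X.
have nullV n : exists A : set X,
    [/\ open A, A (u n) & bprob_extension mu A = 0%E].
  exact: (cluster_open_null nX (@uniform_regular X) umu (ucl (u n))).
have [V VP] := choice nullV.
have oV : open (\bigcup_n V n) by apply: bigcup_open => n _; have [] := VP n.
have mO A : open A -> measurable (A : set (borel_space (bprob_point mu))).
  exact: open_borel_measurable.
have := cluster_open_pos nX umu cu oV.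
move=> /(_ _ _)/eqP; apply.
- by move=> _ [n _ <-]; exists n => //; have [] := VP n.
- by near=> n; exists n.
(* Countable subadditivity applies because the cover is indexed by the terms of a sequence. *)
apply/negligibleP; first exact: mO.
apply: negligible_bigcup => n; have [oVn _ Vn0] := VP n.
by apply/negligibleP => //; exact: mO.
Unshelve. all: by end_near. Qed.

Theorem proposition4 (R : realType) (X : metricType R) :
  sigma_compact_space (weak_probability R X) -> sigma_compact_space X.
Proof.
(* A cluster point in [X] of a sequence in the preimage is not shown to lie in it, hence the
   closure. *)
move=> [K cK KT]; exists (fun n => closure (dirac_bprob @^-1` K n)) => [n|].
  apply: (@compact_closure_cluster R) => u uK.
  have [|mu [_ umu]] := cK n ((dirac_bprob \o u) @ \oo) _.
    by exists 0%N => // m _; exact: uK.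
  exact: cluster_dirac_bprob umu.
apply/seteqP; split => // x _.
have : [set: weak_probability R X] (dirac_bprob x) by [].
by rewrite -KT => -[n _ Kx]; exists n => //; exact: subset_closure.
Qed.
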